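(* Let $a>0$, $\Omega=(-a,a)$, and let $K:\Omega\times\Omega\to\mathbb{R}$ belong to $\mathcal{C}^{(n,n)}(\Omega\times\Omega)$. Let $x_1,\ldots,x_n\in\mathbb{R}$, and for $\varepsilon\ge 0$ small enough that $\varepsilon x_i\in\Omega$ for all $i$ define $\mathbf{K}_\varepsilon=[K(\varepsilon x_i,\varepsilon x_j)]_{i,j=1}^{n}$. Then: 1. As $\varepsilon\to 0$, \[\det(\mathbf{K}_\varepsilon)=\varepsilon^{n(n-1)}\Big(\det(\mathbf{V}_{\le n-1})^2\det\mathbf{W}_{n-1}+\mathcal{O}(\varepsilon)\Big).\] 2. If, for some $\varepsilon_0>0$, $\mathbf{K}_\varepsilon$ is positive semidefinite for all $\varepsilon\in[0,\varepsilon_0]$, and its eigenvalues are ordered $\lambda_1(\varepsilon)\ge\cdots\ge\lambda_n(\varepsilon)\ge0$, then $\lambda_k(\varepsilon)=\mathcal{O}(\varepsilon^{2(k-1)})$ as $\varepsilon\to0$ for each $1\le k\le n$.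
   Context: $K\in\mathcal{C}^{(\ell,\ell)}(\Omega\times\Omega)$ means that all partial derivatives $K^{(i,j)}=\frac{\partial^{i+j}K}{\partial x^i\partial y^j}$ exist and are continuous on $\Omega\times\Omega$ for $0\le i,j\le \ell$. The Wronskian matrix is $\mathbf{W}_k=\Big[\frac{K^{(i,j)}(0,0)}{i!\,j!}\Big]_{i,j=0}^{k}\in\mathbb{R}^{(k+1)\times(k+1)}$. The Vandermonde matrix is $\mathbf{V}_{\le k}=[x_i^{j}]_{1\le i\le n,\,0\le j\le k}\in\mathbb{R}^{n\times(k+1)}$. *)

(* Defs.v *)
From HB Require Import structures.
From mathcomp Require Import all_boot all_order all_algebra.
From mathcomp Require Import all_classical all_reals all_analysis.
Set Implicit Arguments. Unset Strict Implicit. Unset Printing Implicit Defensive.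
Import Order.TTheory GRing.Theory Num.Theory.
Import numFieldNormedType.Exports.
Local Open Scope ring_scope.

Section Defs.
Variable R : realType.

Definition pdy (j : nat) (K : R -> R -> R) : R -> R -> R :=
  iter j (fun g x y => derive1 (g x) y) K.

Definition pdx (i : nat) (K : R -> R -> R) : R -> R -> R :=
  iter i (fun g x y => derive1 (fun t => g t y) x) K.

Definition Kder (i j : nat) (K : R -> R -> R) : R -> R -> R := pdx i (pdy j K).

Definition inOmega (a x : R) : Prop := - a < x < a.

Definition Cll (l : nat) (a : R) (K : R -> R -> R) : Prop :=
  forall x y, inOmega a x -> inOmega a y ->
  forall i j : nat, (i <= l)%N -> (j <= l)%N ->
    [/\ (j < l)%N -> derivable (pdy j K x) y 1,
        (i < l)%N -> derivable (fun t => Kder i j K t y) x 1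
      & {for (x, y), continuous (fun p : R * R => Kder i j K p.1 p.2)}].

Definition Kmat (n : nat) (K : R -> R -> R) (x : 'I_n -> R) (e : R) : 'M[R]_n :=
  \matrix_(i < n, j < n) K (e * x i) (e * x j).

Definition Vand (n : nat) (x : 'I_n -> R) : 'M[R]_n :=
  \matrix_(i < n, j < n) x i ^+ j.

Definition Wr (n : nat) (K : R -> R -> R) : 'M[R]_n :=
  \matrix_(i < n, j < n) (Kder i j K 0 0 / ((i`!)%:R * (j`!)%:R)).

Definition psd (n : nat) (A : 'M[R]_n) : Prop :=
  A^T = A /\ forall v : 'rV[R]_n, 0 <= (v *m A *m v^T) 0 0.

Definition ordered_eigenvalues (n : nat) (A : 'M[R]_n) (lam : 'I_n -> R) : Prop :=
  char_poly A = \prod_(i < n) ('X - (lam i)%:P) /\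
  forall i j : 'I_n, (i <= j)%N -> lam j <= lam i.

End Defs.

(* Main.v *)
Require Import Defs.
From HB Require Import structures.
From mathcomp Require Import all_boot all_order all_algebra.
From mathcomp Require Import all_classical all_reals all_analysis.
From mathcomp Require Import perm complex ring.
Import Order.TTheory GRing.Theory Num.Theory.
Import numFieldNormedType.Exports.
Local Open Scope ring_scope.

(* For weights c, d with sum_i c_i x_i^r = 0 (r < p) and sum_j d_j x_j^s = 0
   (s < q), the function sum_(i, j) c_i d_j K(u x_i, v x_j) has vanishing partial
   derivatives on u = 0 (orders < p in u) and on v = 0 (orders < q in v), so by
   Lagrange's form of Taylor's theorem it is of order e^(p+q) at u = v = e.

   Determinant: if V is invertible and L = V^-1, rows p and q of L are such
   weights, so (L K_e L^T)_pq = e^(p+q) (W_pq + O(e)), and one takes determinants.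
   If V is singular, two points coincide and both sides vanish.

   Eigenvalues: with c = d = v of orders p = q = k, the quadratic form of K_e is
   at most C e^(2k) |v|^2 on a subspace of codimension at most k; conclude by
   the Courant-Fischer principle. *)

(** * Taylor's theorem with Lagrange remainder at a zero of given order *)

Lemma is_derive_expn {R : realType} (n : nat) (u : R) :
  is_derive u 1 (fun t : R => t ^+ n.+1) (n.+1%:R * u ^+ n).
Proof.
have -> : (fun t : R => t ^+ n.+1) = id ^+ n.+1.
  by apply/funext => t; rewrite exprfctE.
by apply: is_derive_eq; rewrite /GRing.scale /= mulr1.
Qed.

(** Here [f r] stands for the r-th derivative of [f 0]; a free family suits partial derivatives in
    either variable. Cauchy's mean value theorem for [f 0] and t^(p+1) gives a point c in ]0, s[,
    and the induction hypothesis applies to the shifted family on [0, c]. *)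
Lemma taylor_vanishing {R : realType} (f : nat -> R -> R) (p : nat) (s : R) :
  0 < s ->
  (forall r (u : R),
     (r < p)%N -> 0 <= u <= s -> is_derive u 1 (f r) (f r.+1 u)) ->
  (forall r, (r < p)%N -> f r 0 = 0) ->
  exists2 xi : R, 0 <= xi <= s & f 0 s = s ^+ p / p`!%:R * f p xi.
Proof.
elim: p f s => [|p IHp] f s s0 fD f0.
  by exists s; rewrite ?(ltW s0) ?lexx // expr0 fact0 divr1 mul1r.
have in_oc (u : R) : u \in `]0, s[ -> 0 <= u <= s.
  by rewrite in_itv /= => /andP[/ltW -> /ltW ->].
have [||||| c c0s] := @cauchy_MVT _ (f 0) (f 1) (fun t => t ^+ p.+1)
    (fun t => p.+1%:R * t ^+ p) 0 s s0.
- apply: derivable_within_continuous => u; rewrite in_itv /= => us.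
  exact: (@ex_derive _ _ _ _ _ _ _ (fD 0%N u isT us)).
- apply: derivable_within_continuous => u _.
  exact: (@ex_derive _ _ _ _ _ _ _ (is_derive_expn p u)).
- by move=> u /in_oc; apply: fD.
- by move=> u _; apply: is_derive_expn.
- move=> u; rewrite in_itv /= => /andP[u0 _].
  by rewrite mulf_neq0 ?expf_neq0 ?pnatr_eq0 // gt_eqF.
move: c0s; rewrite in_itv /= => /andP[c0 cs].
rewrite f0 // expr0n /= !subr0 => E.
have [|| xi xic fc] := IHp (fun r => f r.+1) c c0.
- by move=> r u rp /andP[u0 uc]; apply: fD => //; rewrite u0 (le_trans uc) ?ltW.
- by move=> r rp; apply: f0.
exists xi; first by case/andP: xic => -> /le_trans -> //; apply: ltW.
have sp : s ^+ p.+1 != 0 by rewrite expf_neq0 ?gt_eqF.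
have cp : c ^+ p != 0 by rewrite expf_neq0 ?gt_eqF.
have pf : p`!%:R != 0 :> R by rewrite pnatr_eq0 -lt0n fact_gt0.
have p1 : p.+1%:R != 0 :> R by rewrite pnatr_eq0.
have -> : f 0 s = f 1 c / (p.+1%:R * c ^+ p) * s ^+ p.+1 by rewrite E divfK.
by rewrite fc factS natrM; field; rewrite pf cp addrC natr1 p1.
Qed.

(** Subtracting the monomial [f p 0] t^p / p! raises the order of vanishing at 0 from p to p+1,
    which reduces the claim to [taylor_vanishing]. *)
Lemma taylor_leading {R : realType} (f : nat -> R -> R) (p : nat) (s : R) :
  0 < s ->
  (forall r (u : R),
     (r <= p)%N -> 0 <= u <= s -> is_derive u 1 (f r) (f r.+1 u)) ->
  (forall r, (r < p)%N -> f r 0 = 0) ->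
  exists2 xi : R, 0 <= xi <= s &
    f 0 s = s ^+ p / p`!%:R * f p 0 + s ^+ p.+1 / p.+1`!%:R * f p.+1 xi.
Proof.
move=> s0 fD f0.
(* The r-th derivative of u^p / p!. The zero branch matters at r = p+1, where truncated subtraction
   would give the constant 1. *)
pose P r (u : R) := if (r <= p)%N then u ^+ (p - r) * (p - r)`!%:R^-1 else 0.
have PD r (u : R) : (r <= p)%N -> is_derive u 1 (P r) (P r.+1 u).
  move=> rp; rewrite /P rp; case: ltngtP rp => // [rp|->] _; last first.
    by rewrite subnn; under eq_fun do rewrite expr0; exact: is_derive_cst.
  rewrite -[(p - r)%N]subnSK //; set m := (p - r.+1)%N.
  under eq_fun do rewrite mulrC.
  apply: is_derive_eq; first exact: is_deriveZ (is_derive_expn m u).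
  rewrite /GRing.scale /= factS natrM; field.
  by rewrite addrC natr1 pnatr_eq0 -lt0n fact_gt0 pnatr_eq0.
have [|| xi xis E] := @taylor_vanishing _ (fun r u => f r u - f p 0 * P r u) p.+1 s s0.
- move=> r u rp us.
  by apply: is_deriveB; [exact: fD|apply: is_deriveZ; apply: PD].
- move=> r; rewrite ltnS leq_eqVlt => /predU1P[->|rp].
    by rewrite /P leqnn subnn expr0 fact0 invr1 !mulr1 subrr.
  by rewrite f0 // /P (ltnW rp) expr0n subn_eq0 leqNgt rp /= mul0r mulr0 subr0.
exists xi => //; move: E.
rewrite /P leq0n ltnn mulr0 subr0 subn0 => /eqP; rewrite subr_eq => /eqP ->.
by rewrite addrC [f p 0 * _]mulrC.
Qed.

(** * Spectral theorem and Courant-Fischer bound for real symmetric matrices *)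

Lemma char_poly_conjmx {F : fieldType} (n : nat) (P D : 'M[F]_n) :
  P \in unitmx -> char_poly (invmx P *m D *m P) = char_poly D.
Proof.
move=> uP; rewrite /char_poly.
have -> : char_poly_mx (invmx P *m D *m P)
    = map_mx polyC (invmx P) *m char_poly_mx D *m map_mx polyC P.
  rewrite /char_poly_mx mulmxBr mulmxBl -!map_mxM; congr (_ - _).
  by rewrite scalar_mxC -mulmxA -map_mxM mulVmx // map_mx1 mulmx1.
rewrite !det_mulmx mulrAC -det_mulmx -map_mxM mulVmx // map_mx1 det1.
by rewrite mul1r.
Qed.

Section RealSpectral.
Local Open Scope complex_scope.
Local Open Scope sesquilinear_scope.

(** Over [R[i]] the matrix is normal, hence unitarily diagonalizable. Both its spectrum and [lam]
    factor the characteristic polynomial, so they agree up to a permutation, which is then applied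
    to the eigenvectors. *)
Lemma spectral_real {R : realType} (n : nat) (A : 'M[R]_n) (lam : 'I_n -> R) :
  A^T = A -> char_poly A = \prod_(i < n) ('X - (lam i)%:P) ->
  exists2 U : 'M[R[i]]_n, U \is unitarymx &
    map_mx (real_complex R) A
      = U ^t* *m diag_mx (\row_i (lam i)%:C) *m U.
Proof.
move=> AT Achar; set AC := map_mx _ A.
have /orthomx_spectralP : AC \is normalmx.
  have AR : AC ^t* = AC.
    by apply/matrixP => i j; rewrite !mxE -{1}AT mxE; apply: conjc_real.
  by apply/normalmxP; rewrite AR.
set P := spectralmx _; set D := spectral_diag _ => AE.
have uP : P \is unitarymx by apply: spectral_unitarymx.
have : char_poly AC = \prod_(i < n) ('X - (D 0 i)%:P).
  rewrite AE char_poly_conjmx ?unitarymx_unit // char_poly_trig ?diag_mx_is_trig //.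
  by apply: eq_bigr => i _; rewrite mxE eqxx mulr1n.
rewrite -map_char_poly Achar rmorph_prod /=.
under eq_bigr do rewrite rmorphB /= map_polyX map_polyC /=.
pose tD := [tuple D 0 i | i < n]; pose tl := [tuple (lam i)%:C | i < n].
have prodE (t : n.-tuple R[i]) :
    \prod_(i < n) ('X - (tnth t i)%:P) = \prod_(z <- t) ('X - z%:P).
  by rewrite [RHS]big_tuple.
have -> : \prod_(i < n) ('X - ((lam i)%:C)%:P) = \prod_(z <- tl) ('X - z%:P).
  by rewrite -prodE; apply: eq_bigr => i _; rewrite tnth_mktuple.
have -> : \prod_(i < n) ('X - (D 0 i)%:P) = \prod_(z <- tD) ('X - z%:P).
  by rewrite -prodE; apply: eq_bigr => i _; rewrite tnth_mktuple.
move=> /prod_XsubC_eq /tuple_permP [s sE].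
have lamE i : (lam i)%:C = D 0 (s i).
  have := congr1 (fun t => nth 0 t i) sE.
  by rewrite -!tnth_nth !tnth_mktuple.
(* Rows of [P] are left eigenvectors; permuting them by [s] puts one for [lam i] in row i. *)
exists (row_perm s P).
  apply/unitarymxP; rewrite row_permE trmx_mul map_mxM mulmxA.
  rewrite -(mulmxA (perm_mx s)) (unitarymxP _) // mulmx1.
  rewrite tr_perm_mx map_perm_mx -perm_mxM mulgV perm_mx1 //.
rewrite {1}AE invmx_unitary // row_permE trmx_mul map_mxM -!mulmxA.
congr (_ *m _); rewrite !mulmxA; congr (_ *m _).
apply/matrixP => i j; rewrite tr_perm_mx map_perm_mx -row_permE.
rewrite -[X in perm_mx X]invgK -col_permE !mxE lamE permKV.
by rewrite (inj_eq perm_inj).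
Qed.

(** For v = a + ib and real A the cross terms are purely imaginary. This carries bounds known for
    real vectors over to complex ones. *)
Lemma Re_hermitian_form {R : realType} (n : nat) (A : 'M[R]_n) (v : 'rV[R[i]]_n) :
  let a := map_mx (@complex.Re R) v in let b := map_mx (@complex.Im R) v in
  complex.Re ((v *m map_mx (real_complex R) A *m v ^t*) 0 0)
    = (a *m A *m a^T) 0 0 + (b *m A *m b^T) 0 0.
Proof.
move=> a b; rewrite !mxE raddf_sum -big_split /=; apply: eq_bigr => j _.
rewrite !mxE !mulr_suml raddf_sum -big_split /=; apply: eq_bigr => i _.
rewrite !mxE; case: (v 0 i) (v 0 j) => [x y] [z t] /=.
ring.
Qed.

Lemma map_Re_mulmx {R : realType} (m n p : nat) (v : 'M[R[i]]_(m, n))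
    (G : 'M[R]_(n, p)) :
  map_mx (@complex.Re R) (v *m map_mx (real_complex R) G)
    = map_mx (@complex.Re R) v *m G.
Proof.
apply/matrixP => i j; rewrite !mxE raddf_sum; apply: eq_bigr => l _.
by rewrite !mxE; case: (v i l) => y z /=; rewrite mulr0 subr0.
Qed.

Lemma map_Im_mulmx {R : realType} (m n p : nat) (v : 'M[R[i]]_(m, n))
    (G : 'M[R]_(n, p)) :
  map_mx (@complex.Im R) (v *m map_mx (real_complex R) G)
    = map_mx (@complex.Im R) v *m G.
Proof.
apply/matrixP => i j; rewrite !mxE raddf_sum; apply: eq_bigr => l _.
by rewrite !mxE; case: (v i l) => y z /=; rewrite mulr0 add0r.
Qed.

Lemma kermx_rV {F : fieldType} (m n : nat) (A : 'M[F]_(m, n)) :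
  (n < m)%N -> exists2 v : 'rV[F]_m, v != 0 & v *m A = 0.
Proof.
move=> nm; have : kermx A != 0.
  by rewrite kermx_eq0 /row_free neq_ltn (leq_ltn_trans (rank_leq_col A) nm).
by case/rowV0Pn => v /sub_kermxP vA v0; exists v.
Qed.

(** The left kernel of [G] has codimension at most k, so it meets the span of the k+1 eigenvectors
    for [lam 0], ..., [lam k] (indices start at 0). On that span the form is at least [lam k] times
    the squared norm, which contradicts B < [lam k]. *)
Lemma courant_fischer_le {R : realType} (n : nat) (A : 'M[R]_n)
    (lam : 'I_n -> R) (k : 'I_n) (G : 'M[R]_(n, k)) (B : R) :
  A^T = A -> ordered_eigenvalues A lam ->
  (forall v : 'rV[R]_n, v *m G = 0 ->
     (v *m A *m v^T) 0 0 <= B * (v *m v^T) 0 0) ->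
  lam k <= B.
Proof.
move=> AT [/(spectral_real _ _ _ AT)[U uU AE] lam_le] vB; rewrite leNgt; apply/negP => Bk.
(* In eigenvector coordinates, [u] vanishes beyond position k and satisfies the
   k constraints of [G]: one constraint less than there are unknowns. *)
pose E : 'M[R[i]]_(n, n - k.+1) := \matrix_(i, j) (i == (k.+1 + j)%N :> nat)%:R.
have [|u u0] := @kermx_rV _ _ _ (row_mx (U *m map_mx (real_complex R) G) E).
  by rewrite -addSn subnKC.
rewrite mul_mx_row => /eqP; rewrite row_mx_eq0 => /andP[/eqP uUG /eqP uE].
have u_gt (j : 'I_n) : (k < j)%N -> u 0 j = 0.
  move=> kj; have jn : (j - k.+1 < n - k.+1)%N by rewrite ltn_sub2r // (leq_ltn_trans kj).
  have /matrixP/(_ 0 (Ordinal jn)) := uE; rewrite !mxE (bigD1 j) //= big1 ?addr0.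
    by rewrite mxE /= subnKC // eqxx mulr1.
  by move=> i ij; rewrite mxE /= subnKC // val_eqE (negPf ij) mulr0.
pose v := u *m U.
have vG : v *m map_mx (real_complex R) G = 0 by rewrite -mulmxA.
have UU : U^t* *m U = 1%:M by rewrite -invmx_unitary // mulVmx ?unitarymx_unit.
(* [vB] concerns real vectors only; since [G] is real, the real and imaginary parts of [v] both lie
   in its kernel. *)
have Q_ge0 :
    0 <= complex.Re ((v *m map_mx (real_complex R) (B%:M - A) *m v ^t*) 0 0).
  have form_ge0 (w : 'rV[R]_n) : w *m G = 0 -> 0 <= (w *m (B%:M - A) *m w^T) 0 0.
    move=> /vB; rewrite -subr_ge0 mulmxBr mulmxBl mul_mx_scalar -scalemxAl.
    by rewrite !mxE.
  rewrite Re_hermitian_form addr_ge0 //; apply: form_ge0.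
    by rewrite -map_Re_mulmx vG map_mx0.
  by rewrite -map_Im_mulmx vG map_mx0.
(* In eigenvector coordinates the form of B - A is the sum of (B - lam_j) |u_j|^2. *)
have sum_le0 : \sum_j (lam j - B) * (complex.Re (u 0 j) ^+ 2
                                    + complex.Im (u 0 j) ^+ 2) <= 0.
  rewrite -oppr_ge0; apply: le_trans Q_ge0 _.
  have -> : map_mx (real_complex R) (B%:M - A)
      = U ^t* *m diag_mx (\row_i (B - lam i)%:C) *m U.
    have -> : diag_mx (\row_i (B - lam i)%:C)
        = (B%:C)%:M - diag_mx (\row_i (lam i)%:C) :> 'M[R[i]]_n.
      by apply/matrixP => i j; rewrite !mxE rmorphB mulrnBl.
    rewrite map_mxB map_scalar_mx mulmxBr mulmxBl -AE; congr (_ - _).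
    by rewrite scalar_mxC -mulmxA UU mulmx1.
  rewrite /v trmx_mul map_mxM !mulmxA !mulmxtVK // mul_mx_diag !mxE raddf_sum.
  rewrite -sumrN; apply: ler_sum => j _; rewrite !mxE.
  case: (u 0 j) => y z /=; rewrite le_eqVlt; apply/orP; left; apply/eqP.
  ring.
(* For j > k the coordinate vanishes; for j <= k the ordering gives B < [lam k] <= [lam j]. A
   nonpositive sum of such terms forces u = 0. *)
have term_ge0 j : 0 <= (lam j - B) * (complex.Re (u 0 j) ^+ 2
                                    + complex.Im (u 0 j) ^+ 2).
  have [kj|jk] := ltnP k j; first by rewrite u_gt //= expr0n addr0 mulr0.
  apply: mulr_ge0; last by rewrite addr_ge0 ?sqr_ge0.
  by rewrite subr_ge0 (le_trans (ltW Bk)) ?lam_le.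
case/negP: u0; apply/eqP/rowP => j; rewrite mxE.
have [/u_gt //|jk] := ltnP k j.
have := sum_le0; rewrite le_eqVlt ltNge sumr_ge0 // orbF psumr_eq0 //.
move=> /allP/(_ j (mem_index_enum _)); rewrite mulf_eq0 subr_eq0.
rewrite (gt_eqF (lt_le_trans Bk (lam_le _ _ jk))) /=.
rewrite paddr_eq0 ?sqr_ge0 // !sqrf_eq0.
by case: (u 0 j) => y z /= /andP[/eqP -> /eqP ->].
Qed.

End RealSpectral.

(** * Weighted double sums of kernel values near the origin *)

Lemma Kder_bounded_near0 {R : realType} (a : R) (n : nat) (K : R -> R -> R)
    (p q : nat) :
  0 < a -> Cll n a K -> (p <= n)%N -> (q <= n)%N ->
  exists M delta : R, [/\ 0 < delta, 0 <= M &
    forall s t, `|s| < delta -> `|t| < delta -> `|Kder p q K s t| <= M].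
Proof.
move=> a0 KC pn qn.
have O0 : inOmega a 0 by rewrite /inOmega oppr_lt0 a0.
have [_ _ /cvgr_dist_lt/(_ _ ltr01)] := KC 0 0 O0 O0 p q pn qn.
move=> /nbhs_ballP[delta /= delta0 near_lt].
exists (`|Kder p q K 0 0| + 1), delta; split => // s t sd td.
have := near_lt (s, t); rewrite /= => /(_ _)/ltW.
rewrite distrC => le1; rewrite addrC -lerBlDr; apply: le_trans (le1 _).
  exact: lerB_dist.
by split; rewrite -ball_normE /= sub0r normrN.
Qed.

Lemma scaled_points_small {R : realType} (n : nat) (x : 'I_n -> R) (delta : R) :
  0 < delta -> exists2 eta : R, 0 < eta &
    forall (e s : R) i, e < eta -> 0 <= s <= e -> `|s * x i| < delta.
Proof.
move=> delta0; have X0 : 0 < 1 + \sum_i `|x i| by rewrite ltr_pwDl ?sumr_ge0.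
(* The sum dominates every |x_i|, and the added 1 keeps the denominator positive. *)
exists (delta / (1 + \sum_i `|x i|)); first by rewrite divr_gt0.
move=> e s i; rewrite ltr_pdivlMr // => eX /andP[s0 se].
rewrite normrM ger0_norm //; apply: le_lt_trans eX.
apply: ler_pM => //; rewrite (bigD1 i) //= addrCA lerDl addr_ge0 ?sumr_ge0 //.
Qed.

(* The mixed derivative d^(r+s) / du^r dv^s of the double sum
   sum_(i, j) c_i d_j K(u x_i, v x_j). *)
Definition wform {R : realType} {n : nat} (K : R -> R -> R) (x c d : 'I_n -> R)
    (r s : nat) (u v : R) : R :=
  \sum_i \sum_j c i * x i ^+ r * (d j * x j ^+ s) * Kder r s K (u * x i) (v * x j).

Lemma is_derive_lincomb {R : realType} (n : nat) (b : 'I_n -> R)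
    (h : 'I_n -> R -> R) (dh : 'I_n -> R) (u : R) :
  (forall i, is_derive u 1 (h i) (dh i)) ->
  is_derive u 1 (fun t => \sum_i b i * h i t) (\sum_i b i * dh i).
Proof.
move=> hD.
have -> : (fun t => \sum_i b i * h i t) = \sum_i (fun t => b i * h i t).
  by apply/funext => t; rewrite fct_sumE.
by apply: is_derive_sum => i; apply: is_deriveZ.
Qed.

Lemma is_derive_scale_arg {R : realType} (f df : R -> R) (x u : R) :
  is_derive (u * x) 1 f (df (u * x)) ->
  is_derive u 1 (fun t => f (t * x)) (x * df (u * x)).
Proof.
move=> fD; rewrite mulrC; apply: (@is_derive1_comp _ f ( *%R^~ x)) => //.
have -> : *%R^~ x = (fun t => x * t) by apply/funext => t; rewrite mulrC.
by rewrite -[X in is_derive _ _ _ X]mulr1; apply: is_deriveZ.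
Qed.

Lemma wform_derive_l {R : realType} (a : R) (n N : nat) (K : R -> R -> R)
    (x c d : 'I_n -> R) (r s : nat) (u v : R) :
  Cll N a K -> (r < N)%N -> (s <= N)%N ->
  (forall i, inOmega a (u * x i)) -> (forall j, inOmega a (v * x j)) ->
  is_derive u 1 (fun t => wform K x c d r s t v) (wform K x c d r.+1 s u v).
Proof.
move=> KC rN sN ua va.
(* The factor 1 gives the outer sum the shape of [is_derive_lincomb], which is then used once per
   sum. *)
have -> : (fun t => wform K x c d r s t v) = fun t => \sum_i 1 *
    \sum_j (c i * x i ^+ r * (d j * x j ^+ s)) * Kder r s K (t * x i) (v * x j).
  by apply/funext => t; apply: eq_bigr => i _; rewrite mul1r.
have -> : wform K x c d r.+1 s u v = \sum_i 1 *
    \sum_j (c i * x i ^+ r * (d j * x j ^+ s))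
           * (x i * Kder r.+1 s K (u * x i) (v * x j)).
  apply: eq_bigr => i _; rewrite mul1r; apply: eq_bigr => j _.
  by rewrite exprSr; ring.
apply: is_derive_lincomb => i; apply: is_derive_lincomb => j.
apply: (is_derive_scale_arg (fun t => Kder r s K t (v * x j))
                            (fun t => Kder r.+1 s K t (v * x j))).
rewrite /Kder /= derive1E; apply: derivableP.
by have [_ /(_ rN)] := KC _ _ (ua i) (va j) r s (ltnW rN) sN.
Qed.

(* [Kder r s K] takes the y-derivatives first, so without proving a Schwarz
   theorem only its values at r = 0 are known to be differentiable in y. *)
Lemma wform_derive_r {R : realType} (a : R) (n N : nat) (K : R -> R -> R)
    (x c d : 'I_n -> R) (s : nat) (u v : R) :
  Cll N a K -> (s < N)%N ->
  (forall i, inOmega a (u * x i)) -> (forall j, inOmega a (v * x j)) ->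
  is_derive v 1 (fun t => wform K x c d 0 s u t) (wform K x c d 0 s.+1 u v).
Proof.
move=> KC sN ua va.
have -> : (fun t => wform K x c d 0 s u t) = fun t => \sum_i 1 *
    \sum_j (c i * x i ^+ 0 * (d j * x j ^+ s)) * Kder 0 s K (u * x i) (t * x j).
  by apply/funext => t; apply: eq_bigr => i _; rewrite mul1r.
have -> : wform K x c d 0 s.+1 u v = \sum_i 1 *
    \sum_j (c i * x i ^+ 0 * (d j * x j ^+ s))
           * (x j * Kder 0 s.+1 K (u * x i) (v * x j)).
  apply: eq_bigr => i _; rewrite mul1r; apply: eq_bigr => j _.
  by rewrite [x j ^+ s.+1]exprSr; ring.
apply: is_derive_lincomb => i; apply: is_derive_lincomb => j.
apply: (is_derive_scale_arg (Kder 0 s K (u * x i)) (Kder 0 s.+1 K (u * x i))).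
rewrite /Kder /= derive1E; apply: derivableP.
by have [/(_ sN)] := KC _ _ (ua i) (va j) 0%N s isT (ltnW sN).
Qed.

(** At u = 0 the kernel factor no longer depends on i, so the r-th moment of [c] factors out. *)
Lemma wform_l0 {R : realType} (n : nat) (K : R -> R -> R) (x c d : 'I_n -> R)
    (r s : nat) (v : R) :
  \sum_i c i * x i ^+ r = 0 -> wform K x c d r s 0 v = 0.
Proof.
move=> c0; rewrite /wform exchange_big big1 //= => j _.
under eq_bigr do rewrite mul0r -mulrA.
by rewrite -mulr_suml c0 mul0r.
Qed.

Lemma wform_r0 {R : realType} (n : nat) (K : R -> R -> R) (x c d : 'I_n -> R)
    (r s : nat) (u : R) :
  \sum_j d j * x j ^+ s = 0 -> wform K x c d r s u 0 = 0.
Proof.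
move=> d0; rewrite /wform big1 //= => i _.
under eq_bigr do rewrite mul0r -mulrA mulrCA.
by rewrite -mulr_suml d0 mul0r.
Qed.

Lemma wform00 {R : realType} (n : nat) (K : R -> R -> R) (x c d : 'I_n -> R)
    (r s : nat) :
  wform K x c d r s 0 0
    = (\sum_i c i * x i ^+ r) * (\sum_j d j * x j ^+ s) * Kder r s K 0 0.
Proof.
rewrite /wform mulr_suml [RHS]mulr_suml; apply: eq_bigr => i _.
rewrite mulr_sumr [RHS]mulr_suml; apply: eq_bigr => j _.
by rewrite !mul0r.
Qed.

Lemma wform_bound {R : realType} (n : nat) (K : R -> R -> R) (x c d : 'I_n -> R)
    (r s : nat) (u v M : R) :
  (forall i j, `|Kder r s K (u * x i) (v * x j)| <= M) ->
  `|wform K x c d r s u v|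
    <= (\sum_i `|c i * x i ^+ r|) * (\sum_j `|d j * x j ^+ s|) * M.
Proof.
move=> KM; rewrite /wform mulr_suml mulr_suml.
apply: (le_trans (ler_norm_sum _ _ _)); apply: ler_sum => i _.
rewrite mulr_sumr mulr_suml.
apply: (le_trans (ler_norm_sum _ _ _)); apply: ler_sum => j _.
by rewrite !normrM ler_wpM2l ?mulr_ge0.
Qed.

Lemma inOmega_norm {R : realType} (a t : R) : `|t| < a -> inOmega a t.
Proof. by rewrite ltr_norml. Qed.

(* The y-expansion comes first: the intermediate point v is then a constant
   while expanding in x, and no y-derivative of an x-derivative occurs. *)
Lemma wform_rectangle {R : realType} (a : R) (n N : nat) (K : R -> R -> R)
    (x c d : 'I_n -> R) (p q : nat) (e : R) :
  Cll N a K -> (p <= N)%N -> (q <= N)%N -> 0 < e ->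
  (forall s i, 0 <= s <= e -> inOmega a (s * x i)) ->
  (forall r, (r < p)%N -> \sum_i c i * x i ^+ r = 0) ->
  (forall s, (s < q)%N -> \sum_j d j * x j ^+ s = 0) ->
  exists u v : R, [/\ 0 <= u <= e, 0 <= v <= e &
    wform K x c d 0 0 e e = e ^+ q / q`!%:R * (e ^+ p / p`!%:R
                            * wform K x c d p q u v)].
Proof.
move=> KC pN qN e0 ea cp dq.
have ee : 0 <= e <= e by rewrite (ltW e0) lexx.
have [||v ve ->] := @taylor_vanishing _ (fun s => wform K x c d 0 s e) q e e0.
- move=> s v sq ve; apply: wform_derive_r KC _ _ _; last 2 first.
  + by move=> i; apply: ea.
  + by move=> i; apply: ea.
  exact: leq_trans qN.
- by move=> s sq; rewrite wform_r0 ?dq.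
have [||u ue ->] := @taylor_vanishing _ (fun r u => wform K x c d r q u v) p e e0.
- move=> r u rp ue; apply: wform_derive_l KC _ qN _ _.
  + exact: leq_trans pN.
  + by move=> i; apply: ea.
  + by move=> i; apply: ea.
- by move=> r rp; rewrite wform_l0 ?cp.
by exists u, v.
Qed.

Lemma ler_div_fact {R : realType} (t : R) (m : nat) : 0 <= t -> t / m`!%:R <= t.
Proof.
by move=> t0; rewrite ler_pdivrMr ?ltr0n ?fact_gt0 // ler_peMr // ler1n fact_gt0.
Qed.

(** Expanding in y and then in x isolates the corner term at (0, 0). One more derivative in each
    variable enters the remainders, whence p, q < N. *)
Lemma wform_leading {R : realType} (a : R) (n N : nat) (K : R -> R -> R)
    (x c d : 'I_n -> R) (p q : nat) :
  0 < a -> Cll N a K -> (p < N)%N -> (q < N)%N ->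
  (forall r, (r < p)%N -> \sum_i c i * x i ^+ r = 0) ->
  (forall s, (s < q)%N -> \sum_j d j * x j ^+ s = 0) ->
  exists C delta : R, 0 < delta /\ forall e, 0 < e -> e < delta ->
    `|wform K x c d 0 0 e e - e ^+ (p + q) * (wform K x c d p q 0 0
                                              / (p`!%:R * q`!%:R))|
      <= C * e ^+ (p + q).+1.
Proof.
move=> a0 KC pN qN cp dq.
have [M1 [r1 [r10 M10 K1]]] := Kder_bounded_near0 a N K p.+1 q a0 KC pN (ltnW qN).
have [M2 [r2 [r20 M20 K2]]] := Kder_bounded_near0 a N K p q.+1 a0 KC (ltnW pN) qN.
have min0 : 0 < Num.min a (Num.min r1 r2) by rewrite !lt_min a0 r10 r20.
have [eta eta0 small] := scaled_points_small n x _ min0.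
(* [C1] bounds the remainder of the x-expansion, [C2] that of the y-expansion. *)
pose C1 := (\sum_i `|c i * x i ^+ p.+1|) * (\sum_j `|d j * x j ^+ q|) * M1.
pose C2 := (\sum_i `|c i * x i ^+ p|) * (\sum_j `|d j * x j ^+ q.+1|) * M2.
exists (C1 + C2), eta; split=> // e e0 e_eta.
have xa s i : 0 <= s <= e -> inOmega a (s * x i).
  by move=> /(small _ _ i e_eta); rewrite !lt_min => /andP[/inOmega_norm].
have xr1 s i : 0 <= s <= e -> `|s * x i| < r1.
  by move=> /(small _ _ i e_eta); rewrite !lt_min => /and3P[].
have xr2 s i : 0 <= s <= e -> `|s * x i| < r2.
  by move=> /(small _ _ i e_eta); rewrite !lt_min => /and3P[].
have ee : 0 <= e <= e by rewrite (ltW e0) lexx.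
have oe : 0 <= (0 : R) <= e by rewrite lexx ltW.
have [||v ve ->] := @taylor_leading _ (fun s => wform K x c d 0 s e) q e e0.
- move=> s v sq ve; apply: wform_derive_r KC _ _ _.
  + exact: leq_ltn_trans qN.
  + by move=> i; apply: xa.
  + by move=> i; apply: xa.
- by move=> s sq; rewrite wform_r0 ?dq.
have [||u ue ->] := @taylor_leading _ (fun r u => wform K x c d r q u 0) p e e0.
- move=> r u rp ue; apply: wform_derive_l KC _ (ltnW qN) _ _.
  + exact: leq_ltn_trans pN.
  + by move=> i; apply: xa.
  + by move=> i; apply: xa.
- by move=> r rp; rewrite wform_l0 ?cp.
(* The y-remainder already carries e^(q+1), so in x only its vanishing to order p is used. *)
have [||w we ->] := @taylor_vanishing _ (fun r u => wform K x c d r q.+1 u v) p e e0.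
- move=> r w rp we; apply: wform_derive_l KC _ qN _ _.
  + exact: ltn_trans pN.
  + by move=> i; apply: xa.
  + by move=> i; apply: xa.
- by move=> r rp; rewrite wform_l0 ?cp.
have E1 : `|wform K x c d p.+1 q u 0| <= C1.
  by apply: wform_bound => i j; apply: K1; apply: xr1.
have E2 : `|wform K x c d p q.+1 w v| <= C2.
  by apply: wform_bound => i j; apply: K2; apply: xr2.
have fact_neq0 m : m`!%:R != 0 :> R by rewrite pnatr_eq0 -lt0n fact_gt0.
have eX_ge0 m : 0 <= e ^+ m by rewrite exprn_ge0 ?ltW.
have eXf_ge0 m : 0 <= e ^+ m / m`!%:R by rewrite divr_ge0 ?ler0n.
move: E1 E2; set X := wform K x c d p q 0 0.
set Y := wform K x c d p.+1 q u 0; set Z := wform K x c d p q.+1 w v => E1 E2.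
(* The corner terms cancel; two remainders of order p+q+1 are left. *)
have -> : e ^+ q / q`!%:R * (e ^+ p / p`!%:R * X + e ^+ p.+1 / p.+1`!%:R * Y) +
    e ^+ q.+1 / q.+1`!%:R * (e ^+ p / p`!%:R * Z)
    - e ^+ (p + q) * (X / (p`!%:R * q`!%:R))
  = (e ^+ p.+1 / p.+1`!%:R) * (e ^+ q / q`!%:R) * Y
    + (e ^+ p / p`!%:R) * (e ^+ q.+1 / q.+1`!%:R) * Z.
  by rewrite exprD; field; rewrite !fact_neq0.
rewrite mulrDl; apply: (le_trans (ler_normD _ _)); apply: lerD.
  rewrite mulrC normrM (ger0_norm (mulr_ge0 _ _)) // ler_pM ?mulr_ge0 //.
  by rewrite -addSn exprD ler_pM // ler_div_fact.
rewrite mulrC normrM (ger0_norm (mulr_ge0 _ _)) // ler_pM ?mulr_ge0 //.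
by rewrite -addnS exprD ler_pM // ler_div_fact.
Qed.

(** [C] and [delta] are chosen before the weights: the bound must be uniform in [c], since the
    vectors tested against the matrix vary with e. *)
Lemma wform_diag_bound {R : realType} (a : R) (n N : nat) (K : R -> R -> R)
    (x : 'I_n -> R) (m : nat) :
  0 < a -> Cll N a K -> (m <= N)%N ->
  exists C delta : R, 0 < delta /\ forall (e : R) (c : 'I_n -> R),
    0 < e -> e < delta -> (forall r, (r < m)%N -> \sum_i c i * x i ^+ r = 0) ->
    wform K x c c 0 0 e e <= C * e ^+ (2 * m) * \sum_i c i ^+ 2.
Proof.
move=> a0 KC mN.
have [M [r [r0 M0 KM]]] := Kder_bounded_near0 a N K m m a0 KC mN mN.
have min0 : 0 < Num.min a r by rewrite lt_min a0 r0.
have [eta eta0 small] := scaled_points_small n x _ min0.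
pose S := \sum_i `|x i ^+ m|.
exists (S ^+ 2 * M), eta; split=> // e c e0 e_eta cm.
have xa s i : 0 <= s <= e -> inOmega a (s * x i).
  by move=> /(small _ _ i e_eta); rewrite !lt_min => /andP[/inOmega_norm].
have xr s i : 0 <= s <= e -> `|s * x i| < r.
  by move=> /(small _ _ i e_eta); rewrite !lt_min => /andP[].
have [u [v [ue ve ->]]] := wform_rectangle a n N K x c c m m e KC mN mN e0 xa cm cm.
set T := \sum_i c i ^+ 2.
have T0 : 0 <= T by apply: sumr_ge0 => i _; apply: sqr_ge0.
(* Each |c_i| is at most the Euclidean norm of [c], that is, the square root of [T]. *)
have cS : \sum_i `|c i * x i ^+ m| <= Num.sqrt T * S.
  rewrite /S mulr_sumr; apply: ler_sum => i _.
  rewrite normrM ler_wpM2r // -sqrtr_sqr ler_wsqrtr // /T (bigD1 i) //= lerDl.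
  by apply: sumr_ge0 => j _; apply: sqr_ge0.
have cS0 : 0 <= \sum_i `|c i * x i ^+ m| by apply: sumr_ge0.
have W : `|wform K x c c m m u v| <= T * S ^+ 2 * M.
  apply: le_trans (wform_bound _ _ _ _ _ _ _ _ _ M _) _.
    by move=> i j; apply: KM; apply: xr.
  rewrite ler_wpM2r // -(sqr_sqrtr T0) -exprMn expr2 ler_pM //.
apply: le_trans (ler_norm _) _; rewrite mulrA normrM.
have eX_ge0 : 0 <= e ^+ m by rewrite exprn_ge0 ?ltW.
have eXf_ge0 : 0 <= e ^+ m / m`!%:R by rewrite divr_ge0 ?ler0n.
rewrite (ger0_norm (mulr_ge0 _ _)) //.
have -> : S ^+ 2 * M * e ^+ (2 * m) * T = e ^+ m * e ^+ m * (T * S ^+ 2 * M).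
  by rewrite mul2n -addnn exprD; ring.
by rewrite ler_pM ?mulr_ge0 // ler_pM // ler_div_fact.
Qed.

(** * Calculus of the relation f(e) = l + O(e) as e decreases to 0 *)

Definition linear_near0 {R : realType} (f : R -> R) (l : R) : Prop :=
  exists C delta : R, 0 < delta /\
    forall e, 0 < e -> e < delta -> `|f e - l| <= C * e.

Lemma linear_near0_cst {R : realType} (l : R) : linear_near0 (fun=> l) l.
Proof. by exists 0, 1; split=> // e _ _; rewrite subrr normr0 mul0r. Qed.

Lemma linear_near0D {R : realType} (f g : R -> R) (l m : R) :
  linear_near0 f l -> linear_near0 g m -> linear_near0 (fun e => f e + g e) (l + m).
Proof.
move=> [C1 [r1 [r10 fl]]] [C2 [r2 [r20 gm]]].
exists (C1 + C2), (Num.min r1 r2); split=> [|e e0]; first by rewrite lt_min r10.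
rewrite lt_min => /andP[e1 e2]; rewrite opprD addrACA mulrDl.
by apply: (le_trans (ler_normD _ _)); rewrite lerD ?fl ?gm.
Qed.

Lemma linear_near0M {R : realType} (f g : R -> R) (l m : R) :
  linear_near0 f l -> linear_near0 g m -> linear_near0 (fun e => f e * g e) (l * m).
Proof.
move=> [C1 [r1 [r10 fl]]] [C2 [r2 [r20 gm]]].
(* From fg - lm = (f - l)g + l(g - m), where |g| <= |m| + C2 because e < 1. *)
exists (C1 * (`|m| + C2) + `|l| * C2), (Num.min 1 (Num.min r1 r2)).
split=> [|e e0]; first by rewrite !lt_min ltr01 r10.
rewrite !lt_min => /and3P[e1 er1 er2].
have C20 : 0 <= C2.
  by rewrite -(pmulr_lge0 _ e0); apply: le_trans (gm e e0 er2).
have g_le : `|g e| <= `|m| + C2.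
  rewrite -(subrK m (g e)) addrC; apply: (le_trans (ler_normD _ _)).
  rewrite lerD2l; apply: (le_trans (gm e e0 er2)).
  by rewrite ler_piMr // ltW.
have -> : f e * g e - l * m = (f e - l) * g e + l * (g e - m) by ring.
rewrite [leRHS]mulrDl; apply: (le_trans (ler_normD _ _)); rewrite !normrM.
apply: lerD; last by rewrite -mulrA ler_wpM2l ?gm.
by rewrite mulrAC ler_pM ?fl.
Qed.

(** An arbitrary operation covers both the sum and the products of the Leibniz formula for
    determinants. *)
Lemma linear_near0_big_op {R : realType} (op : R -> R -> R) (idx : R)
    (I : Type) (r : seq I) (P : pred I) (f : I -> R -> R) (l : I -> R) :
  (forall g h u v, linear_near0 g u -> linear_near0 h v ->
     linear_near0 (fun e => op (g e) (h e)) (op u v)) ->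
  (forall i, linear_near0 (f i) (l i)) ->
  linear_near0 (fun e => \big[op/idx]_(i <- r | P i) f i e)
               (\big[op/idx]_(i <- r | P i) l i).
Proof.
move=> opL fl; elim: r => [|i r IHr].
  by rewrite big_nil; under eq_fun do rewrite big_nil; exact: linear_near0_cst.
rewrite big_cons; under eq_fun do rewrite big_cons.
by case: ifP => // _; apply: opL.
Qed.

Lemma linear_near0_det {R : realType} (n : nat) (M : R -> 'M[R]_n) (L : 'M[R]_n) :
  (forall i j, linear_near0 (fun e => M e i j) (L i j)) ->
  linear_near0 (fun e => \det (M e)) (\det L).
Proof.
move=> ML; apply: linear_near0_big_op; first exact: linear_near0D.
move=> s; apply: linear_near0M; first exact: linear_near0_cst.
by apply: linear_near0_big_op => //; exact: linear_near0M.
Qed.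

(** * The determinant *)

(** Rows act as weights: this serves the inverse Vandermonde matrix in the determinant estimate and
    a single row vector in the quadratic form. *)
Lemma wform_mxE {R : realType} (m n : nat) (K : R -> R -> R) (x : 'I_n -> R)
    (e : R) (A B : 'M[R]_(m, n)) (p q : 'I_m) :
  (A *m Kmat K x e *m B^T) p q = wform K x (A p) (B q) 0 0 e e.
Proof.
rewrite mxE /wform exchange_big; apply: eq_bigr => j _.
rewrite !mxE mulr_suml; apply: eq_bigr => i _.
by rewrite !mxE !expr0 !mulr1 mulrAC.
Qed.

(** The squared determinant of diag(1, e, ..., e^(n-1)), which produces the power of e in the
    determinant estimate. *)
Lemma prod_expr_ord {R : comNzRingType} (e : R) (n : nat) :
  (\prod_(i < n) e ^+ i) ^+ 2 = e ^+ (n * n.-1).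
Proof.
elim: n => [|n IHn]; first by rewrite big_ord0 expr1n.
rewrite big_ord_recr exprMn IHn -exprM -exprD; congr (e ^+ _).
by case: n {IHn} => //= n; rewrite -mulnDr addn2 mulnC.
Qed.

Lemma det_Vand_eq0 {R : realType} (n : nat) (x : 'I_n -> R) :
  \det (Vand x) = 0 -> exists2 ij : 'I_n * 'I_n, ij.1 != ij.2 & x ij.1 = x ij.2.
Proof.
have -> : Vand x = (Vandermonde n (\row_i x i))^T.
  by apply/matrixP => i j; rewrite !mxE.
rewrite det_tr det_Vandermonde => /eqP/prodf_eq0[i _ /prodf_eq0[j ij]].
rewrite !mxE subr_eq0 => /eqP xij; exists (i, j) => //=.
by rewrite -val_eqE neq_ltn ij.
Qed.

(** With L = V^-1 and D = diag(e^i), the rescaled matrix [M e] = D^-1 L K_e L^T D^-1 tends entrywise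
    to the Wronskian matrix at linear rate, and hence so do the determinants. *)
Lemma det_Kmat_unit {R : realType} (a : R) (n : nat) (K : R -> R -> R)
    (x : 'I_n -> R) :
  0 < a -> Cll n a K -> Vand x \in unitmx ->
  exists C delta : R, 0 < delta /\
     forall e : R, 0 < e -> e < delta ->
       `| \det (Kmat K x e)
          - e ^+ (n * n.-1) * (\det (Vand x) ^+ 2 * \det (Wr n K)) |
       <= C * e ^+ (n * n.-1).+1.
Proof.
move=> a0 KC Vu; pose L := invmx (Vand x).
have LV (p r : 'I_n) : \sum_i L p i * x i ^+ r = (p == r)%:R.
  have /matrixP/(_ p r) := mulVmx Vu; rewrite !mxE => <-.
  by apply: eq_bigr => i _; rewrite [Vand x i r]mxE.
(* Off-diagonal entries of L V = 1: row p of [L] kills all powers below p, while its p-th moment is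
   1. *)
have L0 (p : 'I_n) r : (r < p)%N -> \sum_i L p i * x i ^+ r = 0.
  move=> rp; have rn := ltn_trans rp (ltn_ord p).
  by rewrite (LV p (Ordinal rn)) -val_eqE gtn_eqF.
pose M e : 'M[R]_n :=
  \matrix_(p, q) ((L *m Kmat K x e *m L^T) p q / e ^+ (p + q)).
have [C [delta [delta0 detM]]] : linear_near0 (fun e => \det (M e)) (\det (Wr n K)).
  apply: linear_near0_det => p q.
  have [C [delta [delta0 lead]]] :=
    wform_leading a n n K x (L p) (L q) p q a0 KC (ltn_ord p) (ltn_ord q) (L0 p) (L0 q).
  exists C, delta; split=> // e e0 /(lead _ e0).
  rewrite wform00 !LV !eqxx !mul1r => lead_e.
  have ep : 0 < e ^+ (p + q) by rewrite exprn_gt0.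
  have ME : M e p q = wform K x (L p) (L q) 0 0 e e / e ^+ (p + q).
    by rewrite mxE wform_mxE.
  rewrite ME [Wr n K p q]mxE -[X in _ - X](mulKf (lt0r_neq0 ep)) mulrC -mulrBr.
  rewrite normrM gtr0_norm ?invr_gt0 // ler_pdivrMl //. rewrite [leRHS]mulrCA -exprSr; exact: lead_e.
exists (\det (Vand x) ^+ 2 * C), delta; split=> // e e0 /(detM _ e0) Me.
have V0 : \det (Vand x) != 0 by rewrite -unitfE -unitmxE.
pose D : 'M[R]_n := diag_mx (\row_i e ^+ i).
(* Undoing the rescaling: det L contributes det(V)^-1 twice, and det D twice gives e^(n(n-1)). *)
have KE : \det (Kmat K x e) = \det (Vand x) ^+ 2 * e ^+ (n * n.-1) * \det (M e).
  have LKL : L *m Kmat K x e *m L^T = D *m M e *m D.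
    apply/matrixP => p q; rewrite mul_mx_diag mxE mul_diag_mx !mxE.
    rewrite exprD; field.
    by rewrite !expf_neq0 ?gt_eqF.
  have := congr1 determinant LKL; rewrite !det_mulmx det_tr det_inv det_diag.
  under eq_bigr do rewrite mxE.
  rewrite -prod_expr_ord => /(congr1 ( *%R (\det (Vand x) ^+ 2))) E.
  rewrite -[LHS]mul1r; transitivity (\det (Vand x) ^+ 2 *
    ((\det (Vand x))^-1 * \det (Kmat K x e) * (\det (Vand x))^-1)).
    by field.
  by rewrite E; ring.
have -> : \det (Kmat K x e) - e ^+ (n * n.-1) * (\det (Vand x) ^+ 2 * \det (Wr n K))
    = \det (Vand x) ^+ 2 * e ^+ (n * n.-1) * (\det (M e) - \det (Wr n K)).
  by rewrite KE; ring.
have VeN : 0 <= \det (Vand x) ^+ 2 * e ^+ (n * n.-1).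
  by rewrite mulr_ge0 ?sqr_ge0 ?exprn_ge0 ?ltW.
rewrite normrM (ger0_norm VeN); apply: le_trans (ler_wpM2l VeN Me) _.
by rewrite [e ^+ _.+1]exprSr mulrACA.
Qed.

(** * The eigenvalues, and the two statements together *)

(** A left eigenvector v satisfies v A v^T = lam_i |v|^2 with |v|^2 > 0. *)
Lemma psd_eigenvalue_ge0 {R : realType} (n : nat) (A : 'M[R]_n) (lam : 'I_n -> R)
    (i : 'I_n) :
  psd A -> ordered_eigenvalues A lam -> 0 <= lam i.
Proof.
move=> [_ A_ge0] [Achar _].
have : eigenvalue A (lam i).
  rewrite eigenvalue_root_char Achar /root horner_prod (bigD1 i) //=.
  by rewrite hornerXsubC subrr mul0r.
case/eigenvalueP => v vA v0; have := A_ge0 v.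
rewrite vA -scalemxAl mxE pmulr_lge0 // mxE.
under eq_bigr do rewrite mxE -expr2.
rewrite lt_def sumr_ge0 ?andbT => [|j _]; last exact: sqr_ge0.
apply: contra v0 => /eqP S0; apply/eqP/rowP => j; rewrite mxE.
move: S0 => /eqP; rewrite psumr_eq0 => [/allP/(_ j (mem_index_enum _))|l _].
  by rewrite sqrf_eq0 => /eqP.
exact: sqr_ge0.
Qed.

Theorem theorem4p1 (R : realType) (a : R) (n : nat) (K : R -> R -> R)
    (x : 'I_n -> R) :
  0 < a -> Cll n a K ->
  (exists C delta : R, 0 < delta /\
     forall e : R, 0 < e -> e < delta ->
       `| \det (Kmat K x e)
          - e ^+ (n * n.-1) * (\det (Vand x) ^+ 2 * \det (Wr n K)) |
       <= C * e ^+ (n * n.-1).+1)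
  /\
  (forall (e0 : R) (lam : R -> 'I_n -> R),
     0 < e0 ->
     (forall e, 0 <= e <= e0 -> psd (Kmat K x e)) ->
     (forall e, 0 <= e <= e0 -> ordered_eigenvalues (Kmat K x e) (lam e)) ->
     forall k : 'I_n, exists C delta : R, 0 < delta /\ delta <= e0 /\
       forall e : R, 0 < e -> e < delta -> `| lam e k | <= C * e ^+ (2 * k)).
Proof.
move=> a0 KC; split.
  have [Vu|] := boolP (Vand x \in unitmx); first exact: det_Kmat_unit a0 KC Vu.
  (* Coinciding points give two equal rows of K_e, so both determinants vanish and C = 0 works with
     any positive [delta]. *)
  rewrite unitmxE unitfE negbK => /eqP V0; exists 0, 1; split=> // e _ _.
  have [[i j] /= ij xij] := det_Vand_eq0 _ _ V0.
  rewrite (determinant_alternate ij) => [|l]; last by rewrite !mxE xij.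
  by rewrite V0 expr0n !mul0r mulr0 subrr normr0.
move=> e0 lam e00 Kpsd Keig k.
(* The ordinal [k] counts from 0, so k vanishing moments yield the exponent 2k, which is 2(k-1) when
   counting from 1. *)
have [C [delta [delta0 Kv]]] := wform_diag_bound a n n K x k a0 KC (ltnW (ltn_ord k)).
exists C, (Num.min delta e0); split; first by rewrite lt_min delta0.
split=> [|e epos]; first by rewrite ge_min lexx orbT.
rewrite lt_min => /andP[e_delta e_e0].
have e_in : 0 <= e <= e0 by rewrite !ltW.
rewrite ger0_norm; last exact: psd_eigenvalue_ge0 (Kpsd e e_in) (Keig e e_in).
(* The first k Vandermonde columns: v G = 0 says that the moments of v of orders below k vanish. *)
pose G : 'M[R]_(n, k) := \matrix_(i, j) x i ^+ j.
apply: (courant_fischer_le _ _ _ _ G) (Keig e e_in) _; first by case: (Kpsd e e_in).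
move=> v vG; rewrite wform_mxE.
have -> : (v *m v^T) 0 0 = \sum_i v 0 i ^+ 2.
  by rewrite mxE; apply: eq_bigr => i _; rewrite mxE expr2.
apply: Kv => // r rk; have /matrixP/(_ 0 (Ordinal rk)) := vG; rewrite !mxE => vG0.
by rewrite -[RHS]vG0; apply: eq_bigr => i _; rewrite mxE.
Qed.
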